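(* Let $x^0\in\mathbb{R}^n$ and let $S=[s^1\; s^2\; \cdots\; s^n]\in\mathbb{R}^{n\times n}$. Define $U_0=S$ and, for $k\in\{1,\dots,n\}$, $$U_k=[\,s^1-s^k\;\; s^2-s^k\;\cdots\; s^{k-1}-s^k\;\; -s^k\;\; s^{k+1}-s^k\;\cdots\; s^n-s^k\,]\in\mathbb{R}^{n\times n}.$$ Then for each $k\in\{0,1,\dots,n\}$, $|\mathcal{S}(x^0;S,U_k)|\le (n+1)(n+2)/2$. Moreover, if $S$ has full rank, then $|\mathcal{S}(x^0;S,U_k)|=(n+1)(n+2)/2$ for each $k\in\{0,1,\dots,n\}$.
   Context: For $x^0\in\mathbb{R}^n$, $S=[s^1\cdots s^m]\in\mathbb{R}^{n\times m}$ and $T=[t^1\cdots t^k]\in\mathbb{R}^{n\times k}$, the set $\mathcal{S}(x^0;S,T)$ (the ''set for nested-set Hessian computation'', NSHC) is the set of all distinct points at which a function is evaluated when computing its nested-set Hessian at $x^0$ over $S$ and $T$. The nested-set Hessian is $\nabla_s^2 f(x^0;S,T)=(S^\top)^\dagger\,\delta_{\nabla_s f}(x^0;S,T)$, where $\delta_{\nabla_s f}(x^0;S,T)\in\mathbb{R}^{m\times n}$ has $i$-th row $(\nabla_s f(x^0+s^i;T)-\nabla_s f(x^0;T))^\top$, $\nabla_s f(x;T)=(T^\top)^\dagger\big(f(x+t^j)-f(x)\big)_{j=1}^k$ and $\dagger$ is the Moore--Penrose pseudoinverse. Explicitly, $$\mathcal{S}(x^0;S,T)=\{x^0\}\cup\{x^0+s^i\}_{i}\cup\{x^0+t^j\}_{j}\cup\{x^0+s^i+t^j\}_{i,j}.$$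 *)

(* Defs.v *)
From mathcomp Require Import all_boot all_order all_algebra finmap.
From mathcomp Require Import reals.
Set Implicit Arguments.
Unset Strict Implicit.
Unset Printing Implicit Defensive.
Import GRing.Theory.
Local Open Scope fset_scope.
Local Open Scope ring_scope.

(* A matrix in R^(n x m) is identified with the list of its columns:
   s^i is [col i S], and points of R^n are column vectors. As a finite set,
   [NSHC x0 S T] counts coinciding evaluation points only once. *)
Definition NSHC (R : realType) (n m p : nat) (x0 : 'cV[R]_n)
    (S : 'M[R]_(n, m)) (T : 'M[R]_(n, p)) : {fset 'cV[R]_n} :=
  [fset x0]
  `|` [fset x0 + col i S | i : 'I_m]
  `|` [fset x0 + col j T | j : 'I_p]
  `|` [fset x0 + col i S + col j T | i : 'I_m, j : 'I_p].

(* The matrix U_k for 0 <= k <= n. Columns are numbered from 1 in the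
   mathematics and from 0 here: either k = 0, or k = lift ord0 l with value
   l + 1, and then s^k is [col l S]. *)
Definition Umx (R : realType) (n : nat) (S : 'M[R]_n) (k : 'I_n.+1) :
    'M[R]_n :=
  if unlift ord0 k is Some l then
    \matrix_(i, j) (if j == l then - S i l else S i j - S i l)
  else S.

(* Main.v *)
Require Import Defs.
From mathcomp Require Import all_boot all_order all_algebra finmap.
From mathcomp Require Import reals.
From mathcomp Require Import perm.
Set Implicit Arguments.
Unset Strict Implicit.
Unset Printing Implicit Defensive.
Local Open Scope fset_scope.
Local Open Scope ring_scope.

(** The columns of [S] together with the origin are the [n + 1] vertices
    [v_0 = 0, v_1, ..., v_n] of a (possibly degenerate) simplex, and
    [NSHC x0 S T] is the Minkowski sum of [x0] with the vertex sets of [S] and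
    of [T].  Passing from [S] to [U_k] translates the simplex so that its
    vertex [k] sits at the origin: the vertices of [U_k] are the [v_b - v_k],
    with the labels [0] and [k] exchanged ([vertex_Umx]).  The evaluation
    points are therefore the [x0 - v_k + (v_a + v_b)], with [a] and [b]
    ranging independently over [n + 1] labels, and by symmetry in [a] and [b]
    they are indexed by the pairs [a <= b] ([NSHC_Umx]).  There are
    [(n + 1)(n + 2) / 2] such pairs, whence the bound.

    If [S] is invertible, then distinct sorted pairs give distinct points:
    in the basis formed by the columns of [S], the coordinates of [v_a + v_b]
    are the multiplicities of the nonzero labels in the multiset [{a, b}], and
    the multiplicity of the label [0] follows because the multiset has two
    elements ([vertexD_inj]). *)

Import GRing.Theory Num.Theory.

Definition vertex (R : realType) (n m : nat) (S : 'M[R]_(n, m))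
    (a : 'I_m.+1) : 'cV[R]_n :=
  if unlift ord0 a is Some i then col i S else 0.

Lemma vertex0 (R : realType) (n m : nat) (S : 'M[R]_(n, m)) :
  vertex S ord0 = 0.
Proof. by rewrite /vertex unlift_none. Qed.

Lemma vertex_lift (R : realType) (n m : nat) (S : 'M[R]_(n, m)) (i : 'I_m) :
  vertex S (lift ord0 i) = col i S.
Proof. by rewrite /vertex liftK. Qed.

(** The four pieces of [NSHC] are the cases where each of the two labels is
    or is not that of the origin. *)
Lemma mem_NSHC (R : realType) (n m p : nat) (x0 : 'cV[R]_n)
    (S : 'M[R]_(n, m)) (T : 'M[R]_(n, p)) (y : 'cV[R]_n) :
  reflect (exists a b, y = x0 + vertex S a + vertex T b)
          (y \in NSHC x0 S T).
Proof.
apply: (iffP idP).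
  rewrite /NSHC !in_fsetU in_fset1 => /orP[/orP[/orP[/eqP->|]|]|].
  - by exists ord0, ord0; rewrite !vertex0 !addr0.
  - case/imfsetP=> i _ ->; exists (lift ord0 i), ord0.
    by rewrite vertex_lift vertex0 addr0.
  - case/imfsetP=> j _ ->; exists ord0, (lift ord0 j).
    by rewrite vertex_lift vertex0 addr0.
  - case/imfset2P=> i _ [j _ ->]; exists (lift ord0 i), (lift ord0 j).
    by rewrite !vertex_lift.
case=> a [b ->]; rewrite /NSHC !in_fsetU in_fset1.
case: (unliftP ord0 a) => [i|] ->; case: (unliftP ord0 b) => [j|] ->;
  rewrite ?vertex_lift ?vertex0 ?addr0.
- by apply/orP; right; apply/imfset2P; exists i => //; exists j.
- by do 2!(apply/orP; left); apply/orP; right; apply/imfsetP; exists i.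
- by apply/orP; left; apply/orP; right; apply/imfsetP; exists j.
- by rewrite eqxx.
Qed.

(** [U_k] is [S] seen from its vertex [k]: that vertex becomes the origin, and
    the old origin takes over the column that it leaves free. *)
Lemma vertex_Umx (R : realType) (n : nat) (S : 'M[R]_n) (k b : 'I_n.+1) :
  vertex (Umx S k) b = vertex S (tperm ord0 k b) - vertex S k.
Proof.
case: (unliftP ord0 b) => [j|] ->; last first.
  by rewrite tpermL subrr vertex0.
rewrite vertex_lift /Umx; case: unliftP => [l|] ->; last first.
  by rewrite tperm1 perm1 vertex0 subr0 vertex_lift.
rewrite vertex_lift; have [->|neq_jl] := eqVneq j l.
  by rewrite tpermR vertex0; apply/colP=> i; rewrite !mxE eqxx sub0r.
rewrite tpermD ?neq_lift ?(inj_eq lift_inj) 1?eq_sym //.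
by rewrite vertex_lift; apply/colP=> i; rewrite !mxE (negPf neq_jl).
Qed.

(** A sorted pair encodes an unordered pair, repetition allowed. *)
Definition sorted_pairs (N : nat) : {set 'I_N * 'I_N} :=
  [set p : 'I_N * 'I_N | (p.1 <= p.2)%N].

Lemma card_sorted_pairs (N : nat) :
  #|sorted_pairs N| = ((N * N.+1) %/ 2)%N.
Proof.
have -> : ((N * N.+1) %/ 2)%N = 'C(N.+1, 2) by rewrite bin2 divn2 mulnC.
rewrite -bin2_sum big_nat_recl // add0n big_mkord -sum1dep_card.
rewrite -(pair_big_dep xpredT (fun a b : 'I_N => (a <= b)%N) (fun _ _ => 1%N)).
rewrite (exchange_big_dep xpredT) //=; apply: eq_bigr => b _.
by rewrite (big_ord_narrow (ltn_ord b)) sum1_card card_ord.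
Qed.

Definition NSHC_point (R : realType) (n : nat) (x0 : 'cV[R]_n) (S : 'M[R]_n)
    (k : 'I_n.+1) (p : 'I_n.+1 * 'I_n.+1) : 'cV[R]_n :=
  x0 - vertex S k + (vertex S p.1 + vertex S p.2).

(** Since [tperm ord0 k] is a bijection, the label [c] of the shifted vertex is
    as free as [a]; exchanging the two does not move the point, which allows
    them to be sorted. *)
Lemma NSHC_Umx (R : realType) (n : nat) (x0 : 'cV[R]_n) (S : 'M[R]_n)
    (k : 'I_n.+1) :
  NSHC x0 S (Umx S k)
  = [fset NSHC_point x0 S k p | p in sorted_pairs n.+1].
Proof.
apply/fsetP=> y; apply/mem_NSHC/imfsetP => /=.
  case=> a [b ->]; rewrite vertex_Umx; set c := tperm _ _ _.
  have -> : x0 + vertex S a + (vertex S c - vertex S k)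
            = NSHC_point x0 S k (a, c).
    by rewrite [RHS]addrACA /= [- _ + _]addrC.
  have [le_ac|/ltnW le_ca] := leqP a c.
    by exists (a, c) => //; rewrite inE.
  by exists (c, a); [rewrite inE |
    rewrite /NSHC_point /= [vertex S a + _]addrC].
case=> -[a b] _ ->; exists a, (tperm ord0 k b).
by rewrite vertex_Umx tpermK [LHS]addrACA /= [- _ + _]addrC.
Qed.

(** A sorted pair is determined by the multiplicities of its positive entries:
    [0] fills the places that they leave.  Ignoring [0] is essential, because
    [vertex S ord0] vanishes and leaves no trace in the evaluation points. *)
Lemma sorted_pair_eq (a b c d : nat) :
    (a <= b)%N -> (c <= d)%N ->
    (forall x, (0 < x)%N ->
       ((x == a) + (x == b) = (x == c) + (x == d))%N) ->
  a = c /\ b = d.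
Proof.
(* A positive [q] above [s] would have multiplicity zero in the second pair. *)
have max_le p q r s : (r <= s)%N ->
    (forall x, (0 < x)%N ->
       ((x == p) + (x == q) = (x == r) + (x == s))%N) -> (q <= s)%N.
  move=> le_rs eq_mult; rewrite leqNgt; apply/negP=> lt_sq.
  have := eq_mult q (leq_ltn_trans (leq0n s) lt_sq).
  by rewrite eqxx (gtn_eqF lt_sq) (gtn_eqF (leq_ltn_trans le_rs lt_sq)) addn1.
move=> le_ab le_cd eq_mult.
have eq_bd : b = d.
  apply/eqP; rewrite eqn_leq (max_le a b c d) // (max_le c d a b) // => x x_gt0.
  by rewrite eq_mult.
split=> //; move: eq_mult; rewrite eq_bd => eq_mult.
have eq_mult1 x : (0 < x)%N -> (x == a) = (x == c).
  by move=> /eq_mult/addIn; do 2!case: (x == _).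
case: (posnP a) => [a0|/eq_mult1]; last by rewrite eqxx => /esym/eqP.
case: (posnP c) => [->|/eq_mult1] //; by rewrite eqxx => /eqP.
Qed.

(** Multiplying by the inverse of [S] turns the nonzero vertices into the
    standard basis, so that [vertex S a + vertex S b] becomes the vector of
    multiplicities of the nonzero labels, read in characteristic zero. *)
Lemma vertexD_inj (R : realType) (n : nat) (S : 'M[R]_n) :
  \rank S = n ->
  {in sorted_pairs n.+1 &, injective (fun p => vertex S p.1 + vertex S p.2)}.
Proof.
move=> rankS [a b] [c d]; rewrite !inE /= => le_ab le_cd eqv.
have unitS : S \in unitmx by rewrite -row_free_unit /row_free rankS.
have coord (e : 'I_n.+1) (i : 'I_n) :
    (invmx S *m vertex S e) i 0 = (lift ord0 i == e)%:R.
  case: (unliftP ord0 e) => [j|] ->; last first.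
    by rewrite vertex0 mulmx0 mxE eq_sym (negPf (neq_lift _ _)).
  by rewrite vertex_lift colE mulKmx // mxE andbT (inj_eq lift_inj).
suff eq_mult x : (0 < x)%N ->
    ((x == a) + (x == b) = (x == c) + (x == d))%N.
  have [eq_ac eq_bd] := sorted_pair_eq le_ab le_cd eq_mult.
  by congr (_, _); apply: val_inj.
move=> x_gt0; have [x_le|x_gt] := ltnP x n.+1; last first.
  (* No label reaches [x], so all four multiplicities vanish. *)
  have far (e : 'I_n.+1) : (x == e) = false.
    by apply/negbTE; rewrite neq_ltn (leq_trans (ltn_ord e)) ?orbT.
  by rewrite !far.
have lt_xn : (x.-1 < n)%N by rewrite -ltnS prednK.
have xE : x = lift ord0 (Ordinal lt_xn) by rewrite lift0 /= prednK.
rewrite xE !val_eqE; apply/eqP; rewrite -(eqr_nat R) !natrD -!coord.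
by have /(congr1 (fun v => (invmx S *m v) (Ordinal lt_xn) 0)) := eqv;
  rewrite !mulmxDr !mxE => ->.
Qed.

Theorem proposition3p2 (R : realType) (n : nat) (x0 : 'cV[R]_n)
    (S : 'M[R]_n) :
  (forall k : 'I_n.+1,
     (#|` NSHC x0 S (Umx S k)| <= (n.+1 * n.+2) %/ 2)%N) /\
  (\rank S = n ->
   forall k : 'I_n.+1,
     #|` NSHC x0 S (Umx S k)| = ((n.+1 * n.+2) %/ 2)%N).
Proof.
split=> [k|rankS k]; rewrite NSHC_Umx -card_sorted_pairs.
  by rewrite cardE leq_imfset_card.
rewrite card_in_imfset ?cardE //= => p q p_in q_in /addrI.
exact: vertexD_inj.
Qed.
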